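(* Goncharov's 22-term relation is subsumed in Wojtkowiak's family of trilogarithm equations. Precisely: let $K=\mathbb{Q}(t_1,t_2,t_3)$ and let $\overline{K}$ be an algebraic closure. Then the class in $V(\overline{K})$ of the 22-term element $R_{22}(t_1,t_2,t_3)$ is a $\mathbb{Q}$-linear combination of classes of elements of the form $$W_{\phi,A,B,C}(x)-W_{\phi,A,B,C}(x'),$$ where $\phi$ is a non-constant rational function over $\overline{K}$, $A,B,C\in\mathbb{P}^1(\overline{K})$ are distinct, and $x,x'\in\mathbb{P}^1(\overline{K})$ are such that all cross ratios occurring are defined.
   Context: For a field $E$ of characteristic $0$ let $\mathbb{Q}[\mathbb{P}^1(E)]$ be the $\mathbb{Q}$-vector space with basis the symbols $[x]$, $x\in\mathbb{P}^1(E)$, and let $V(E)$ be its quotient by the subspace spanned by $[0]$, $[\infty]$, all inversion relations $[x]-[1/x]$, and all 3-term relations $[x]+[1/(1-x)]+[1-1/x]-[1]$ (elementary functional equations of the trilogarithm, modulo which one works). 22-term relation: with $t_1,t_2,t_3$ independent variables and $t_4=(t_1t_2t_3)^{-1}$, $$R_{22}(t_1,t_2,t_3)=\sum_{i}[t_i]+\sum_{i\ne j}\Big[\frac{1-t_i}{1-t_j^{-1}}\Big]-\frac14\sum_{i\neq j}[t_it_j]-\frac18\sum_{\{i,j,k,l\}=\{1,2,3,4\}}\Big[\frac{(1-t_i)(1-t_j)}{(1-t_k^{-1})(1-t_l^{-1})}\Big]-3[1],$$ where $i,j$ run through $\{1,2,3,4\}$, sums over $i\neq j$ are over ordered pairs,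 and the last sum is over all $24$ orderings $(i,j,k,l)$ of $\{1,2,3,4\}$. Wojtkowiak's family: write $\mathrm{cr}(x,y,z,w)=\frac{x-z}{x-w}\cdot\frac{y-w}{y-z}$ for the cross ratio and $[x,y,z,w]=[\mathrm{cr}(x,y,z,w)]$. For a rational function $\phi$ of degree $n\ge1$ over an algebraically closed field $E$ of characteristic $0$ and distinct $A,B,C\in\mathbb{P}^1(E)$, let $\phi^{-1}(A)=\{\alpha_i\}_{i=1}^n$, $\phi^{-1}(B)=\{\beta_i\}_{i=1}^n$, $\phi^{-1}(C)=\{\gamma_i\}_{i=1}^n$ (with multiplicity) and put $$\begin{aligned}W_{\phi,A,B,C}(x)=&\,[\phi(x),C,B,A]-\sum_{i,j,k=1}^n[x,\gamma_i,\beta_j,\alpha_k]-\sum_{i,j,k=1}^n[x,\alpha_i,\alpha_j,\gamma_k]-\sum_{i,j,k=1}^n[x,\beta_i,\beta_j,\gamma_k]\\&+\sum_{i,j,k=1}^n[x,\alpha_i,\alpha_j,\beta_k]+\sum_{i,j,k=1}^n[x,\beta_i,\beta_j,\alpha_k].\end{aligned}$$ Terms whose second and third entries coincide (e.g. $\alpha_i=\alpha_j$ in $[x,\alpha_i,\alpha_j,\gamma_k]$) have cross ratio identically $\infty$ in $x$ and are set to zero for all $x$. (Wojtkowiak's functional equation says that over $\mathbb{C}$ the one-valued trilogarithm takes a value on $W_{\phi,A,B,C}(x)$ that is independent of $x$.) *)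

(* Defs.v *)
From HB Require Import structures.
From mathcomp Require Import all_boot all_order all_algebra all_fingroup.
From mathcomp Require Import generic_quotient ring_quotient.
From mathcomp Require Import boolp.
From mathcomp Require Export freeg mpoly.

Set Implicit Arguments.
Unset Strict Implicit.
Unset Printing Implicit Defensive.

Import GRing.Theory.
Local Open Scope ring_scope.
Local Open Scope quotient_scope.

Section Span.
Variables (F : fieldType) (M : lmodType F).
Implicit Type S : M -> Prop.

Definition in_span S (u : M) : Prop :=
  exists (m : nat) (c : 'I_m -> F) (v : 'I_m -> M),
    (forall k, S (v k)) /\ u = \sum_(k < m) c k *: v k.

Lemma in_span0 S : in_span S 0.
Proof.
exists 0%N, (fun=> 0), (fun=> 0); split; first by case.
by rewrite big_ord0.
Qed.

Lemma in_spanD S u v : in_span S u -> in_span S v -> in_span S (u + v).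
Proof.
move=> [m [c [f [Sf ->]]]] [n [d [g [Sg ->]]]].
exists (m + n)%N, (fun k => match split k with inl i => c i | inr j => d j end),
  (fun k => match split k with inl i => f i | inr j => g j end).
split=> [k|]; first by case: (split k).
rewrite big_split_ord /=; congr (_ + _); apply: eq_bigr => i _.
  by have /= -> := unsplitK (inl i : 'I_m + 'I_n)%type.
by have /= -> := unsplitK (inr i : 'I_m + 'I_n)%type.
Qed.

Lemma in_spanZ S a u : in_span S u -> in_span S (a *: u).
Proof.
move=> [m [c [f [Sf ->]]]]; exists m, (fun k => a * c k), f; split=> //.
by rewrite scaler_sumr; apply: eq_bigr => k _; rewrite scalerA.
Qed.

Definition span_pred S : {pred M} := [pred u | `[< in_span S u >]].

Lemma span_predP S u : reflect (in_span S u) (u \in span_pred S).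
Proof. exact: asboolP. Qed.

Lemma span_zmod_closed S : zmod_closed (span_pred S).
Proof.
split=> [|u v /span_predP Su /span_predP Sv]; apply/span_predP.
  exact: in_span0.
by rewrite -scaleN1r; apply: in_spanD => //; apply: in_spanZ.
Qed.

HB.instance Definition _ S :=
  GRing.isZmodClosed.Build M (span_pred S) (span_zmod_closed S).

(* The vector space M / <S>. *)
Definition quot_span S := Quotient.quot (span_pred S).

HB.instance Definition _ S := GRing.Zmodule.on (quot_span S).

Definition quot_class S (u : M) : quot_span S := \pi_(quot_span S) u.

Lemma quot_classP S u v :
  quot_class S u = quot_class S v <-> in_span S (u - v).
Proof.
rewrite /quot_class; split=> [/eqP|/span_predP Suv].
  by rewrite -Quotient.idealrBE => /span_predP.
by apply/eqP; rewrite -Quotient.idealrBE.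
Qed.

Lemma quot_classB S : zmod_morphism (quot_class S).
Proof. by move=> u v; rewrite /quot_class !piE. Qed.

HB.instance Definition _ S :=
  GRing.isZmodMorphism.Build M (quot_span S) (quot_class S) (@quot_classB S).

Definition quot_scale S (a : F) (x : quot_span S) : quot_span S :=
  quot_class S (a *: repr x).

Lemma quot_scaleE S a u : quot_scale a (quot_class S u) = quot_class S (a *: u).
Proof.
apply/quot_classP; rewrite -scalerBr; apply: in_spanZ; apply/quot_classP.
exact: reprK.
Qed.

Lemma quot_class_surj S (x : quot_span S) : exists u, x = quot_class S u.
Proof. by exists (repr x); rewrite /quot_class reprK. Qed.

Fact quot_scaleA S a b (x : quot_span S) :
  quot_scale a (quot_scale b x) = quot_scale (a * b) x.
Proof. by have [u ->] := quot_class_surj x; rewrite !quot_scaleE scalerA. Qed.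

Fact quot_scale1 S : left_id 1 (@quot_scale S).
Proof.
by move=> x; have [u ->] := quot_class_surj x; rewrite quot_scaleE scale1r.
Qed.

Fact quot_scaleDr S : right_distributive (@quot_scale S) +%R.
Proof.
move=> a x y; have [u ->] := quot_class_surj x.
have [v ->] := quot_class_surj y.
by rewrite -raddfD !quot_scaleE scalerDr raddfD.
Qed.

Fact quot_scaleDl S (x : quot_span S) :
  {morph (@quot_scale S)^~ x : a b / a + b}.
Proof.
move=> a b; have [u ->] := quot_class_surj x.
by rewrite !quot_scaleE scalerDl raddfD.
Qed.

HB.instance Definition _ S := GRing.Zmodule_isLmodule.Build F (quot_span S)
  (@quot_scaleA S) (@quot_scale1 S) (@quot_scaleDr S) (@quot_scaleDl S).

End Span.

Section ProjectiveLine.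
Variable E : fieldType.

(* [Some a] is the affine point a, [None] is the point at infinity. *)
Definition P1 := option E.
HB.instance Definition _ := Choice.on P1.

Definition hcoord (x : P1) : E * E := if x is Some a then (a, 1) else (1, 0).

(* The point u / v; meaningful only when (u, v) != (0, 0). *)
Definition ratio_pt (u v : E) : P1 := if v == 0 then None else Some (u / v).

Definition inv_pt (x : P1) : P1 := ratio_pt (hcoord x).2 (hcoord x).1.

(* x |-> 1 / (1 - x) *)
Definition inv_onem_pt (x : P1) : P1 :=
  ratio_pt (hcoord x).2 ((hcoord x).2 - (hcoord x).1).

(* x |-> 1 - 1 / x *)
Definition onem_inv_pt (x : P1) : P1 :=
  ratio_pt ((hcoord x).1 - (hcoord x).2) (hcoord x).1.

(* Difference x - y in homogeneous coordinates. *)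
Definition hdiff (x y : P1) : E :=
  (hcoord x).1 * (hcoord y).2 - (hcoord x).2 * (hcoord y).1.

Definition cr_num (x y z w : P1) : E := hdiff x z * hdiff y w.
Definition cr_den (x y z w : P1) : E := hdiff x w * hdiff y z.

Definition cr_defined (x y z w : P1) : bool :=
  (cr_num x y z w != 0) || (cr_den x y z w != 0).

Definition cr (x y z w : P1) : P1 := ratio_pt (cr_num x y z w) (cr_den x y z w).

Definition QP1 := {freeg P1 / rat}.
HB.instance Definition _ := GRing.Lmodule.on QP1.

Definition symb (x : P1) : QP1 := [freeg [:: (1, x)]].
Definition symb_fin (a : E) : QP1 := symb (Some a).

Variant trilog_relator : QP1 -> Prop :=
  | Rel_zero : trilog_relator (symb_fin 0)
  | Rel_infty : trilog_relator (symb None)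
  | Rel_inversion x : trilog_relator (symb x - symb (inv_pt x))
  | Rel_three_term x : trilog_relator
      (symb x + symb (inv_onem_pt x) + symb (onem_inv_pt x) - symb_fin 1).

Definition V := quot_span trilog_relator.
HB.instance Definition _ := GRing.Lmodule.on V.

Definition Vclass (u : QP1) : V := quot_class trilog_relator u.

Definition R22 (t1 t2 t3 : E) : QP1 :=
  let t := tnth [tuple t1; t2; t3; (t1 * t2 * t3)^-1] in
  \sum_(i < 4) symb_fin (t i)
  + \sum_(i < 4) \sum_(j < 4 | i != j) symb_fin ((1 - t i) / (1 - (t j)^-1))
  - (4%:R^-1 : rat) *: (\sum_(i < 4) \sum_(j < 4 | i != j) symb_fin (t i * t j))
  - (8%:R^-1 : rat) *: (\sum_(s : 'S_4)
      symb_fin ((1 - t (s (inord 0))) * (1 - t (s (inord 1)))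
        / ((1 - (t (s (inord 2)))^-1) * (1 - (t (s (inord 3)))^-1))))
  - (3%:R : rat) *: symb_fin 1.

(* A rational function in lowest terms, as a map P^1 -> P^1 (the constant map
   to infinity, with zero denominator, is included). *)
Record ratfun := RatFun {
  rf_num : {poly E};
  rf_den : {poly E};
  rf_coprime : coprimep rf_num rf_den
}.

Definition rf_degree (phi : ratfun) : nat :=
  (maxn (size (rf_num phi)) (size (rf_den phi))).-1.

Definition rf_eval (phi : ratfun) (x : P1) : P1 :=
  if x is Some a then ratio_pt (rf_num phi).[a] (rf_den phi).[a]
  else ratio_pt (rf_num phi)`_(rf_degree phi) (rf_den phi)`_(rf_degree phi).

(* Its roots in E are the affine points of the fibre of phi over A. *)
Definition fibre_poly (phi : ratfun) (A : P1) : {poly E} :=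
  (hcoord A).2 *: rf_num phi - (hcoord A).1 *: rf_den phi.

End ProjectiveLine.

Section Wojtkowiak.
Variable E : closedFieldType.
Implicit Types (phi : ratfun E) (A B C x y z w : P1 E).

(* phi^{-1}(A) with multiplicities. The multiplicity of infinity is the drop
   in degree of [fibre_poly]; for non-constant phi the size is the degree. *)
Definition fibre phi A : seq (P1 E) :=
  map Some (sval (closed_field_poly_normal (fibre_poly phi A)))
  ++ nseq ((rf_degree phi).+1 - size (fibre_poly phi A)) None.

(* [x, y, z, w], with the convention that it vanishes when y = z. *)
Definition cr_symb x y z w : QP1 E :=
  if y == z then 0 else symb (cr x y z w).

Definition W phi A B C x : QP1 E :=
  let al := fibre phi A in let be := fibre phi B in let ga := fibre phi C in
  cr_symb (rf_eval phi x) C B A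
  - \sum_(c <- ga) \sum_(b <- be) \sum_(a <- al) cr_symb x c b a
  - \sum_(a <- al) \sum_(a' <- al) \sum_(c <- ga) cr_symb x a a' c
  - \sum_(b <- be) \sum_(b' <- be) \sum_(c <- ga) cr_symb x b b' c
  + \sum_(a <- al) \sum_(a' <- al) \sum_(b <- be) cr_symb x a a' b
  + \sum_(b <- be) \sum_(b' <- be) \sum_(a <- al) cr_symb x b b' a.

(* Terms with y = z are discarded for every x, so impose no condition. *)
Definition cr_symb_defined x y z w : bool := (y == z) || cr_defined x y z w.

Definition W_defined phi A B C x : Prop :=
  let al := fibre phi A in let be := fibre phi B in let ga := fibre phi C in
  cr_symb_defined (rf_eval phi x) C B A /\
  [/\ {in ga & be & al, forall c b a, cr_symb_defined x c b a},
      {in al & al & ga, forall a a' c, cr_symb_defined x a a' c},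
      {in be & be & ga, forall b b' c, cr_symb_defined x b b' c},
      {in al & al & be, forall a a' b, cr_symb_defined x a a' b} &
      {in be & be & al, forall b b' a, cr_symb_defined x b b' a}].

Definition W_difference_class (v : V E) : Prop :=
  exists phi A B C x x',
    [/\ (0 < rf_degree phi)%N,
        [&& A != B, B != C & A != C],
        W_defined phi A B C x,
        W_defined phi A B C x' &
        v = Vclass (W phi A B C x - W phi A B C x')].

End Wojtkowiak.

(* Q(t_1, t_2, t_3) *)
Notation Qt := {fraction {mpoly rat[3]}}.

Definition tgen (i : 'I_3) : Qt := tofrac 'X_i.

(* Main.v *)
From HB Require Import structures.
Require Import Defs.
From mathcomp Require Import all_boot all_order all_algebra.
From mathcomp Require Import all_fingroup boolp ring.

Set Implicit Arguments.
Unset Strict Implicit.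
Unset Printing Implicit Defensive.

Import GRing.Theory.
Local Open Scope ring_scope.

(** The 22-term element is a single difference of two values of one
    Wojtkowiak element of degree 2.

    Fix [p = t1 t2], [t3] and [t4 = 1 / (p t3)], and let [x] be a coordinate
    on the line.  Putting [x] for [t1] and [p / x] for [t2] makes
    [(1 - t1) (1 - t2)] the quadratic function
    [phi x = (1 - x) (x - p) / x], which is invariant under [x -> p / x].
    Its fibres over [oo], [0] and [(1 - 1/t3) (1 - 1/t4)] are the pairs
    [{0, oo}], [{1, p}] and [{1/t3, 1/t4}] of this involution.  For these
    fibres, take the terms of [W phi oo 0 C x] at [x = t1].
    - The term in [phi x] is the degree-2 term of [R22] for the splitting
      [12|34].
    - The 8 cross ratios taking one point from each fibre are, up to
      inversion, the terms [(1 - ti) / (1 - 1/tj)] with [i] and [j] on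
      different sides of [12|34].
    - The cross ratios with two points of the same fibre come in pairs
      [[u] + [1 - u]], which the three-term relation turns into
      [[1] - [1 - 1/u]]; the resulting 8 arguments are [t1], [t2],
      [t1 t3], [t1 t4], [(1 - t1) / (1 - 1/t2)], [(1 - t2) / (1 - 1/t1)] and
      the degree-2 terms of the other two splittings.

    So [- W(t1)] contains all terms of [R22] which vary with [x] ([W_at_t1]).
    The remaining ones, [t3], [t4], [t1 t2], [(1 - t3) / (1 - 1/t4)] and
    [(1 - t4) / (1 - 1/t3)], together with [- 3 [1]], are exactly what is left
    of [W] at [x = oo] ([W_at_infty]).  Hence [R22 = W(oo) - W(t1)] as soon as
    the points involved are in general position ([R22_is_W_difference]).  For
    independent variables general position is checked by specializing all of
    them to 2. *)

(** * The classes of symbols modulo the elementary relations *)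

Notation T e := (Vclass (symb_fin (e))).

Lemma mem_in_span (F : fieldType) (M : lmodType F) (S : M -> Prop) (u : M) :
  S u -> in_span S u.
Proof.
move=> Su; exists 1%N, (fun=> 1), (fun=> u); split=> //.
by rewrite big_ord1 scale1r.
Qed.

Section TrilogQuotient.
Variable E : fieldType.
Implicit Types (n d k e : E) (u v : QP1 E).

HB.instance Definition _ := GRing.isZmodMorphism.Build (QP1 E) (V E)
  (@Vclass E) (@quot_classB _ _ (@trilog_relator E)).

Lemma VclassD u v : Vclass (u + v) = Vclass u + Vclass v.
Proof. exact: raddfD. Qed.

Lemma VclassB u v : Vclass (u - v) = Vclass u - Vclass v.
Proof. exact: raddfB. Qed.

Lemma VclassZ (q : rat) u : Vclass (q *: u) = q *: Vclass u.
Proof. exact/esym/quot_scaleE. Qed.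

Lemma Vclass_relator u : trilog_relator u -> Vclass u = 0.
Proof.
move=> ru; rewrite -[RHS](raddf0 (@Vclass E)); apply/quot_classP.
by rewrite subr0; apply: mem_in_span.
Qed.

(** Cross ratios are given by a numerator and a denominator either of which
    may vanish, so the elementary relations are restated for the homogeneous
    coordinates of a point; in this form they have no exceptional cases. *)
Definition tri n d : V E := Vclass (symb (ratio_pt n d)).

Lemma triE n d e : d != 0 -> n = e * d -> tri n d = T e.
Proof. by move=> d0 ->; rewrite /tri /ratio_pt (negPf d0) mulfK. Qed.

Lemma tri0l d : tri 0 d = 0.
Proof.
rewrite /tri /ratio_pt mul0r; apply: Vclass_relator.
by case: ifP => _; constructor.
Qed.

Lemma tri0r n : tri n 0 = 0.
Proof. by rewrite /tri /ratio_pt eqxx; apply: Vclass_relator; constructor. Qed.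

Lemma triN n d : tri (- n) (- d) = tri n d.
Proof. by rewrite /tri /ratio_pt oppr_eq0 invrN mulrNN. Qed.

Lemma triC n d : tri n d = tri d n.
Proof.
have [->|n0] := eqVneq n 0; first by rewrite tri0l tri0r.
have [->|d0] := eqVneq d 0; first by rewrite tri0l tri0r.
apply/eqP; rewrite -subr_eq0 -VclassB; apply/eqP/Vclass_relator.
have -> : ratio_pt d n = inv_pt (ratio_pt n d); last by constructor.
rewrite /inv_pt /ratio_pt (negPf d0) (negPf n0) /= mulf_eq0 invr_eq0.
by rewrite (negPf d0) (negPf n0) /= mul1r invf_div.
Qed.

Lemma T_inv e : T e^-1 = T e.
Proof.
have [->|e0] := eqVneq e 0; first by rewrite invr0.
by rewrite -(@triE 1 e) ?mulVf // triC (@triE _ _ e) ?oner_neq0 ?mulr1.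
Qed.

Lemma tri_diag k : k != 0 -> tri k k = T 1.
Proof. by move=> k0; rewrite (@triE _ _ 1) ?mul1r. Qed.

Lemma tri_three_term n d : (n != 0) || (d != 0) ->
  tri n d + tri (d - n) d + tri (n - d) n = T 1.
Proof.
have [-> /= d0|n0 _] := eqVneq n 0.
  by rewrite tri0l tri0r subr0 add0r addr0 tri_diag.
have [->|d0] := eqVneq d 0; first by rewrite !tri0r !add0r subr0 tri_diag.
have -> : tri n d = T (n / d) by rewrite (@triE _ _ (n / d)) ?divfK.
have nd0 : n / d != 0 by rewrite mulf_neq0 ?invr_eq0.
have -> : tri (d - n) d = Vclass (symb (inv_onem_pt (Some (n / d)))).
  rewrite triC /tri /inv_onem_pt /ratio_pt /=; congr (Vclass (symb _)).
  have -> : 1 - n / d = (d - n) / d by rewrite mulrBl divff.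
  rewrite mulf_eq0 invr_eq0 (negPf d0) orbF.
  by case: ifP => // _; rewrite mul1r invf_div.
have -> : tri (n - d) n = Vclass (symb (onem_inv_pt (Some (n / d)))).
  rewrite /tri /onem_inv_pt /ratio_pt /= (negPf n0) (negPf nd0).
  congr (Vclass (symb (Some _))).
  by field; rewrite n0 d0.
apply/eqP; rewrite -subr_eq0 -!VclassD -VclassB; apply/eqP/Vclass_relator.
exact: Rel_three_term.
Qed.

Lemma T_onem_sum e : e != 0 -> T (1 - e) + T (1 - e^-1) = T 1 - T e.
Proof.
move=> e0; rewrite -(@tri_three_term e 1) ?e0 //.
rewrite (@triE e 1 e) ?(@triE (1 - e) 1 (1 - e)) ?oner_neq0 ?mulr1 //.
rewrite (@triE (e - 1) e (1 - e^-1)) //; last by rewrite mulrBl mul1r mulVf.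
by rewrite [RHS](ACl ((1*4)*(2*3))) /= subrr add0r.
Qed.

(** The two arguments are inverse to each other: their product is the product
    of the four parameters. *)
Lemma T_quad_swap (a b c d : E) :
  [/\ a != 0, b != 0, c != 0 & d != 0] ->
  [/\ a != 1, b != 1, c != 1 & d != 1] -> a * b * c * d = 1 ->
  T ((1 - c) * (1 - d) / ((1 - a^-1) * (1 - b^-1)))
  = T ((1 - a) * (1 - b) / ((1 - c^-1) * (1 - d^-1))).
Proof.
move=> [a0 b0 c0 d0] [a1 b1 c1 d1] abcd.
rewrite -T_inv; congr (Vclass (symb_fin _)); apply: mulr1_eq.
rewrite -[RHS]abcd; field.
by rewrite a0 b0 c0 d0 !subr_eq0 a1 b1 c1 d1.
Qed.

End TrilogQuotient.

(** * Sums over pairs and permutations of four indices *)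

Section SmallSums.
Variable M : nmodType.

Lemma sum_pair4 (F : nat -> nat -> M) :
  \sum_(i < 4) \sum_(j < 4 | i != j) F i j
  = F 0%N 1%N + F 1%N 0%N + (F 2%N 3%N + F 3%N 2%N)
    + (F 0%N 2%N + F 2%N 0%N + (F 1%N 3%N + F 3%N 1%N)
       + (F 0%N 3%N + F 3%N 0%N + (F 1%N 2%N + F 2%N 1%N))).
Proof.
under eq_bigr do rewrite big_mkcond.
rewrite !big_ord_recl !big_ord0 /= /bump /= !add0r !addr0 !add1n.
by rewrite [LHS](AC ((1*2)*((1*2)*((1*2)*(1*2))))
  (((1*4)*(9*12))*(((2*7)*(6*11))*((3*10)*(5*8))))).
Qed.

(** [(i, s) |-> lift_perm ord0 i s] is injective and hence, by counting, a
    bijection onto the permutations. *)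
Lemma sum_perm_recl n (F : 'S_n.+1 -> M) :
  \sum_s F s = \sum_(i < n.+1) \sum_(s : 'S_n) F (lift_perm ord0 i s).
Proof.
rewrite pair_bigA.
rewrite (reindex (fun p : 'I_n.+1 * 'S_n => lift_perm ord0 p.1 p.2)) //.
apply/onW_bij/inj_card_bij.
  move=> [i s] [j r] /= eq_sr; have eq_ij : i = j.
    by have /permP/(_ ord0) := eq_sr; rewrite !lift_perm_id.
  rewrite eq_ij in eq_sr *; congr (_, _); apply/permP=> k.
  have /permP/(_ (lift ord0 k)) := eq_sr.
  by rewrite !lift_perm_lift => /lift_inj.
by rewrite card_prod card_ord !card_Sn factS.
Qed.

Lemma sum_perm4_lift (F : 'I_4 -> 'I_4 -> 'I_4 -> 'I_4 -> M) :
  \sum_(s : 'S_4) F (s (inord 0)) (s (inord 1)) (s (inord 2)) (s (inord 3))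
  = \sum_(i < 4) \sum_(j < 3) \sum_(k < 2) \sum_(l < 1)
      F i (lift i j) (lift i (lift j k)) (lift i (lift j (lift k l))).
Proof.
have -> : inord 0 = ord0 :> 'I_4 by apply/val_inj; rewrite /= inordK.
have -> : inord 1 = lift ord0 ord0 :> 'I_4 by apply/val_inj; rewrite /= inordK.
have -> : inord 2 = lift ord0 (lift ord0 ord0) :> 'I_4.
  by apply/val_inj; rewrite /= inordK.
have -> : inord 3 = lift ord0 (lift ord0 (lift ord0 ord0)) :> 'I_4.
  by apply/val_inj; rewrite /= inordK.
rewrite sum_perm_recl; apply: eq_bigr => i _.
rewrite sum_perm_recl; apply: eq_bigr => j _.
rewrite sum_perm_recl; apply: eq_bigr => k _.
rewrite sum_perm_recl; apply: eq_bigr => l _.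
under eq_bigr do rewrite !(lift_perm_id, lift_perm_lift).
by rewrite sumr_const card_Sn.
Qed.

(** A function which depends only on the splitting [ij|kl] of the indices
    takes each of its three values on 8 permutations. *)
Lemma sum_perm4_splitting (F : nat -> nat -> nat -> nat -> M) :
  (forall i j k l, F i j k l = F j i k l) ->
  (forall i j k l, F i j k l = F i j l k) ->
  F 2%N 3%N 0%N 1%N = F 0%N 1%N 2%N 3%N ->
  F 1%N 3%N 0%N 2%N = F 0%N 2%N 1%N 3%N ->
  F 1%N 2%N 0%N 3%N = F 0%N 3%N 1%N 2%N ->
  \sum_(s : 'S_4) F (s (inord 0)) (s (inord 1)) (s (inord 2)) (s (inord 3))
  = (F 0%N 1%N 2%N 3%N + F 0%N 2%N 1%N 3%N + F 0%N 3%N 1%N 2%N) *+ 8.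
Proof.
move=> FCl FCr F1 F2 F3.
rewrite (sum_perm4_lift (fun i j k l : 'I_4 => F i j k l)).
have F10 k l : F 1%N 0%N k l = F 0%N 1%N k l by [].
have F20 k l : F 2%N 0%N k l = F 0%N 2%N k l by [].
have F30 k l : F 3%N 0%N k l = F 0%N 3%N k l by [].
have F21 k l : F 2%N 1%N k l = F 1%N 2%N k l by [].
have F31 k l : F 3%N 1%N k l = F 1%N 3%N k l by [].
have F32 k l : F 3%N 2%N k l = F 2%N 3%N k l by [].
have G10 k l : F k l 1%N 0%N = F k l 0%N 1%N by [].
have G20 k l : F k l 2%N 0%N = F k l 0%N 2%N by [].
have G30 k l : F k l 3%N 0%N = F k l 0%N 3%N by [].
have G21 k l : F k l 2%N 1%N = F k l 1%N 2%N by [].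
have G31 k l : F k l 3%N 1%N = F k l 1%N 3%N by [].
have G32 k l : F k l 3%N 2%N = F k l 2%N 3%N by [].
rewrite !big_ord_recl !big_ord0 /= /bump /= !addr0 !add1n.
rewrite !(F10, F20, F30, F21, F31, F32, G10, G20, G30, G21, G31, G32).
rewrite !(F1, F2, F3).
(* The 24 terms form four blocks, one for each value of the first index; each
   block is twice the sum of the three values, in varying order. *)
move: (F _ _ _ _) (F _ _ _ _) (F _ _ _ _) => x y z.
rewrite -!mulr2n -!mulrnDl (mulrnA _ 4 2); congr (_ *+ 2).
rewrite (addrCA y x z) (addrC x (y + z)) (addrC y z) (addrC x y) !addrA.
by rewrite !mulrS mulr0n addr0 !addrA.
Qed.

End SmallSums.

(** * Cross ratios *)

Section CrossRatio.
Variable E : closedFieldType.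
Implicit Types (e : E) (x y z w : P1 E).

Lemma hdiff_eq0 x y : (hdiff x y == 0) = (x == y).
Proof.
rewrite /hdiff; case: x y => [a|] [b|] /=.
- by rewrite mulr1 mul1r subr_eq0; apply/eqP/eqP => [->|[]].
- by rewrite mulr0 mul1r sub0r oppr_eq0 oner_eq0.
- by rewrite mulr1 mul0r subr0 oner_eq0.
- by rewrite mulr0 mul0r subr0 !eqxx.
Qed.

Lemma cr_symb_definedE x y z w : cr_symb_defined x y z w =
  [|| y == z, x != w | (x != z) && (y != w)].
Proof.
rewrite /cr_symb_defined /cr_defined /cr_num /cr_den !mulf_eq0 !hdiff_eq0.
by rewrite !negb_or; case: (y == z) => //=; rewrite andbT orbC.
Qed.

Definition crV x y z w : V E := Vclass (cr_symb x y z w).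

Lemma crV_tri x y z w : y != z ->
  crV x y z w = tri (cr_num x y z w) (cr_den x y z w).
Proof. by rewrite /crV /cr_symb => /negPf->. Qed.

Lemma crV_direct x y z w e : y != z -> x != w ->
  cr_num x y z w = e * cr_den x y z w -> crV x y z w = T e.
Proof.
move=> yz xw ?; rewrite crV_tri //; apply: triE => //.
by rewrite mulf_neq0 ?hdiff_eq0.
Qed.

Lemma crV_inverse x y z w e : y != z -> x != z -> y != w ->
  cr_den x y z w = e * cr_num x y z w -> crV x y z w = T e.
Proof.
move=> yz xz yw ?; rewrite crV_tri // triC; apply: triE => //.
by rewrite mulf_neq0 ?hdiff_eq0.
Qed.

Lemma crV_diag x y w : crV x y y w = 0.
Proof. by rewrite /crV /cr_symb eqxx raddf0. Qed.

Lemma crV_0 x y w : crV x y x w = 0.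
Proof.
have [->|xy] := eqVneq y x; first exact: crV_diag.
have /eqP xx : hdiff x x == 0 by rewrite hdiff_eq0.
by rewrite crV_tri // /cr_num xx mul0r tri0l.
Qed.

Lemma crV_infty x y z : crV x y z x = 0.
Proof.
have [->|xy] := eqVneq y z; first exact: crV_diag.
have /eqP xx : hdiff x x == 0 by rewrite hdiff_eq0.
by rewrite crV_tri // /cr_den xx mul0r tri0r.
Qed.

Lemma crV_1 x z w : x != z -> x != w -> crV x x z w = T 1.
Proof. by move=> xz xw; apply: crV_direct => //; rewrite mul1r /cr_num mulrC. Qed.

(** Exchanging [y] and [z] replaces the cross ratio [u] by [1 - u] (the
    Pluecker relation), and [1 - 1/u] is, up to inversion, the cross ratio
    with [w] moved to the second place. *)
Lemma crV_swap x y z w : y != z -> x != w -> w != z ->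
  crV x y z w + crV x z y w = T 1 - crV x w z y.
Proof.
move=> yz xw wz; rewrite !crV_tri // 1?eq_sym //.
set n := cr_num x y z w; set d := cr_den x y z w.
have -> : cr_num x z y w = n - d.
  by rewrite /n /d /cr_num /cr_den /hdiff; ring.
have -> : cr_den x z y w = - d.
  by rewrite /d /cr_den /hdiff; ring.
have -> : cr_num x w z y = - n by rewrite /n /cr_num /hdiff; ring.
have -> : cr_den x w z y = - (n - d).
  by rewrite /n /d /cr_num /cr_den /hdiff; ring.
have /tri_three_term <- : (n != 0) || (d != 0).
  by rewrite [d != 0]mulf_neq0 ?hdiff_eq0 ?orbT.
by rewrite triN (triC n (n - d)) addrK -(opprB d n) triN.
Qed.

End CrossRatio.

(** * Wojtkowiak elements of degree two *)

Section DegreeTwo.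
Variable E : closedFieldType.
Implicit Types (phi : ratfun E) (A B C x : P1 E).

Lemma perm_fibre phi A k (s : seq E) : k != 0 ->
  fibre_poly phi A = k *: \prod_(z <- s) ('X - z%:P) ->
  perm_eq (fibre phi A) (map Some s ++ nseq (rf_degree phi - size s) None).
Proof.
move=> k0 phiE; rewrite /fibre phiE; case: closed_field_poly_normal => r /=.
rewrite lead_coefZ (monicP (monic_prod_XsubC _ _ _)) mulr1.
move=> /(scalerI k0) /esym/prod_XsubC_eq rs.
by rewrite size_scale // size_prod_XsubC subSS perm_cat2r perm_map.
Qed.

Lemma big_perm2 (I : eqType) (r : seq I) i j (M : nmodType) (F : I -> M) :
  perm_eq r [:: i; j] -> \sum_(k <- r) F k = F i + F j.
Proof.
by move=> rij; rewrite (perm_big _ rij) !big_cons big_nil /= addr0.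
Qed.

(** The terms with two points of the same fibre are grouped into the pairs to
    which [crV_swap] applies. *)
Lemma Vclass_W2 phi A B C a a' b b' c c' x :
  perm_eq (fibre phi A) [:: a; a'] -> perm_eq (fibre phi B) [:: b; b'] ->
  perm_eq (fibre phi C) [:: c; c'] ->
  let D y z w := crV x y z w + crV x z y w in
  Vclass (W phi A B C x) = crV (rf_eval phi x) C B A
   - (crV x c b a + crV x c b a' + (crV x c b' a + crV x c b' a')
      + (crV x c' b a + crV x c' b a'
         + (crV x c' b' a + crV x c' b' a')))
   - (D a a' c + D a a' c') - (D b b' c + D b b' c')
   + (D a a' b + D a a' b') + (D b b' a + D b b' a').
Proof.
move=> pA pB pC D; rewrite /W.
have double y z u v :
    crV x y y u + crV x y y v + (crV x y z u + crV x y z v)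
    + (crV x z y u + crV x z y v + (crV x z z u + crV x z z v))
    = D y z u + D y z v.
  by rewrite !crV_diag !addr0 !add0r /D addrACA.
rewrite !(big_perm2 _ pA, big_perm2 _ pB, big_perm2 _ pC).
rewrite !(raddfB, raddfD) /= -![Vclass (cr_symb _ _ _ _)]/(crV _ _ _ _).
by rewrite -!opprD !double.
Qed.

End DegreeTwo.

(** * The quadratic function invariant under x -> p / x *)

Section Involution.
Variables (E : closedFieldType) (p : E).
Hypothesis p_neq0 : p != 0.

Let num : {poly E} := (1 - 'X) * ('X - p%:P).

Let num_prod : num = -1 *: \prod_(z <- [:: 1; p]) ('X - z%:P).
Proof. by rewrite /num !big_cons big_nil mulr1 scaleN1r -mulNr opprB. Qed.

Let neg1_neq0 : -1 != 0 :> E. Proof. by rewrite oppr_eq0 oner_neq0. Qed.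

Lemma coprime_invol : coprimep num 'X.
Proof.
rewrite coprimepX /root /num hornerM !hornerE.
by rewrite !(subr0, sub0r) mul1r oppr_eq0.
Qed.

Definition phi_invol : ratfun E := RatFun coprime_invol.

Lemma deg_invol : rf_degree phi_invol = 2%N.
Proof.
by rewrite /rf_degree /= num_prod size_scale // size_prod_XsubC size_polyX.
Qed.

Lemma eval_invol_infty : rf_eval phi_invol None = None.
Proof. by rewrite /rf_eval deg_invol /= coefX /ratio_pt eqxx. Qed.

Lemma eval_invol x : x != 0 ->
  rf_eval phi_invol (Some x) = Some ((1 - x) * (x - p) / x).
Proof. by move=> x0; rewrite /= /ratio_pt !hornerE (negPf x0). Qed.

Lemma fibre_infty : perm_eq (fibre phi_invol None) [:: Some 0; None].
Proof.
have -> : [:: Some 0; None]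
    = map Some [:: 0 : E] ++ nseq (rf_degree phi_invol - 1) None.
  by rewrite deg_invol.
apply: (@perm_fibre _ _ _ (-1)) => //.
by rewrite /fibre_poly /= big_seq1 scale0r scale1r subr0 sub0r scaleN1r.
Qed.

Lemma fibre_zero : perm_eq (fibre phi_invol (Some 0)) [:: Some 1; Some p].
Proof.
have -> : [:: Some 1; Some p]
    = map Some [:: 1; p] ++ nseq (rf_degree phi_invol - 2) None.
  by rewrite deg_invol.
apply: (@perm_fibre _ _ _ (-1)) => //.
by rewrite /fibre_poly /= scale0r scale1r subr0 num_prod.
Qed.

(** [(1 - c) (1 - c')] is the value of [phi_invol] at [c] and at [c' = p/c]. *)
Lemma fibre_pair c c' : c * c' = p ->
  perm_eq (fibre phi_invol (Some ((1 - c) * (1 - c')))) [:: Some c; Some c'].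
Proof.
move=> cp; have -> : [:: Some c; Some c']
    = map Some [:: c; c'] ++ nseq (rf_degree phi_invol - 2) None.
  by rewrite deg_invol.
apply: (@perm_fibre _ _ _ (-1)) => //.
rewrite /fibre_poly /= /num !big_cons big_nil -cp -!mul_polyC.
by rewrite !(polyCM, polyCB, polyCN); ring.
Qed.

End Involution.

(** * The 22-term element as a difference of Wojtkowiak elements *)

Section Configuration.
Variable E : closedFieldType.
Variables t1 t2 t3 : E.
Hypotheses (t1_neq0 : t1 != 0) (t2_neq0 : t2 != 0) (t3_neq0 : t3 != 0).
Hypotheses (t1_neq1 : t1 != 1) (t2_neq1 : t2 != 1) (t3_neq1 : t3 != 1).
Hypotheses (t12_neq1 : t1 * t2 != 1) (t13_neq1 : t1 * t3 != 1).
Hypotheses (t23_neq1 : t2 * t3 != 1) (t123_neq1 : t1 * t2 * t3 != 1).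

Let t4 := (t1 * t2 * t3)^-1.
Let p := t1 * t2.
(* [c4 = 1 / t4]; [c3] and [c4] are exchanged by [x -> p / x]. *)
Let c3 := t3^-1.
Let c4 := t1 * t2 * t3.
Let x := Some t1.
Let z := Some 0 : P1 E.
Let oo := None : P1 E.
Let u := Some 1 : P1 E.

Local Notation Lin a b := (T ((1 - a) / (1 - b^-1))).
Local Notation Quad a b c d :=
  (T ((1 - a) * (1 - b) / ((1 - c^-1) * (1 - d^-1)))).

Let p0 : p != 0. Proof. exact: mulf_neq0. Qed.

Let t4_neq0 : t4 != 0. Proof. by rewrite invr_eq0 !mulf_neq0. Qed.

Let t4_neq1 : t4 != 1. Proof. by rewrite invr_eq1. Qed.

Let prod_t : t1 * t2 * t3 * t4 = 1.
Proof. by rewrite mulfV // !mulf_neq0. Qed.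

(* Points of different fibres differ, and [t1] lies in none of the fibres. *)
Let neqs : ((0 == 1 :> E) = false) * ((0 == p) = false) * ((1 == p) = false)
  * ((0 == c3) = false) * ((1 == c3) = false) * ((p == c3) = false)
  * ((0 == c4) = false) * ((1 == c4) = false) * ((p == c4) = false)
  * ((0 == t1) = false) * ((1 == t1) = false) * ((p == t1) = false)
  * ((t1 == c3) = false) * ((t1 == c4) = false).
Proof.
have mul3 a : (a == c3) = (a * t3 == 1).
  by rewrite -(inj_eq (mulIf t3_neq0)) mulVf.
have c4E : c4 = t1 * (t2 * t3) by rewrite /c4 mulrA.
have eqM (a b : E) : a != 0 -> (a == a * b) = (1 == b).
  by move=> a0; rewrite -{1}(mulr1 a) (inj_eq (mulfI a0)).
rewrite !mul3 eqM // {3}c4E eqM // mul0r mul1r (eq_sym p t1) eqM //.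
do !split; apply/negbTE => //; rewrite 1?eq_sym ?oner_neq0 //.
by rewrite !mulf_neq0.
Qed.

Let phi := phi_invol p0.
Let A := None : P1 E.
Let B := Some 0 : P1 E.
Let C := Some ((1 - c3) * (1 - c4)).

Let fA : perm_eq (fibre phi A) [:: z; oo]. Proof. exact: fibre_infty. Qed.

Let fB : perm_eq (fibre phi B) [:: u; Some p]. Proof. exact: fibre_zero. Qed.

Let fC : perm_eq (fibre phi C) [:: Some c3; Some c4].
Proof. by apply: fibre_pair; rewrite /c3 /c4 mulrC mulfK. Qed.

Let C_neq0 : (1 - c3) * (1 - c4) != 0.
Proof. by rewrite mulf_neq0 // subr_eq0 neqs. Qed.

Let add_onem (a b : V E) : T 1 - a + (T 1 - b) = T 1 *+ 2 - (a + b).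
Proof. by rewrite addrACA -opprD mulr2n. Qed.

Local Ltac distinct :=
  by rewrite /x /z /u /oo ?(inj_eq Some_inj) // ?neqs // eq_sym ?neqs.
Local Ltac cross_ratio := rewrite /cr_num /cr_den /hdiff /= /t4 /p /c3 /c4;
  field; rewrite ?t1_neq0 ?t2_neq0 ?t3_neq0 ?subr_eq0 ?oner_neq0 ?(eq_sym 1)
  ?t1_neq1 ?t2_neq1 ?t3_neq1 ?t123_neq1 //= .
Local Ltac direct := apply: crV_direct; [distinct|distinct|cross_ratio].
Local Ltac inverse :=
  apply: crV_inverse; [distinct|distinct|distinct|cross_ratio].

Lemma W_at_t1 : Vclass (W phi A B C x) =
  Quad t1 t2 t3 t4
  - (Lin t1 t3 + Lin t3 t1 + (Lin t2 t4 + Lin t4 t2)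
     + (Lin t1 t4 + Lin t4 t1 + (Lin t2 t3 + Lin t3 t2)))
  + (T (t1 * t3) + T (t1 * t4)) + (Quad t2 t3 t1 t4 + Quad t2 t4 t1 t3)
  - (T t1 + T t2) - (Lin t1 t2 + Lin t2 t1).
Proof.
rewrite (Vclass_W2 _ fA fB fC) eval_invol //.
have -> : crV (Some ((1 - t1) * (t1 - p) / t1)) C B A = Quad t1 t2 t3 t4.
  apply: crV_direct => //.
  cross_ratio.
have -> : crV x (Some c3) u z = Lin t3 t1 by inverse.
have -> : crV x (Some c3) u oo = Lin t1 t3 by direct.
have -> : crV x (Some c3) (Some p) z = Lin t2 t4 by direct.
have -> : crV x (Some c3) (Some p) oo = Lin t4 t2 by inverse.
have -> : crV x (Some c4) u z = Lin t4 t1 by inverse.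
have -> : crV x (Some c4) u oo = Lin t1 t4 by direct.
have -> : crV x (Some c4) (Some p) z = Lin t2 t3 by direct.
have -> : crV x (Some c4) (Some p) oo = Lin t3 t2 by inverse.
rewrite !crV_swap; try distinct.
have -> : crV x (Some c3) oo z = T (t1 * t3) by inverse.
have -> : crV x (Some c4) oo z = T (t1 * t4) by inverse.
have -> : crV x (Some c3) (Some p) u = Quad t2 t3 t1 t4 by direct.
have -> : crV x (Some c4) (Some p) u = Quad t2 t4 t1 t3 by direct.
have -> : crV x u oo z = T t1 by inverse.
have -> : crV x (Some p) oo z = T t2 by direct.
have -> : crV x z (Some p) u = Lin t1 t2 by inverse.
have -> : crV x oo (Some p) u = Lin t2 t1 by direct.
rewrite !add_onem !opprB (addrC (Lin t3 t1)) (addrC (Lin t4 t1)).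
(* The multiples of [1] cancel: the four families of pairs contribute
   -2, -2, 2 and 2. *)
by rewrite [LHS](AC (2*2*2*2*2) (1*2*3*5*8*10*(4*7)*(6*9))) /= !addNr !addr0.
Qed.

Lemma W_at_infty : Vclass (W phi A B C oo) =
  T t3 + T t4 + (Lin t3 t4 + Lin t4 t3) - T (t1 * t2) - T 1 *+ 3.
Proof.
rewrite (Vclass_W2 _ fA fB fC) eval_invol_infty /A.
rewrite !(crV_0, crV_infty).
have -> : crV oo (Some c3) u z = T (1 - t3) by inverse.
have -> : crV oo (Some c3) (Some p) z = T (1 - t4^-1) by inverse.
have -> : crV oo (Some c4) u z = T (1 - t4) by inverse.
have -> : crV oo (Some c4) (Some p) z = T (1 - t3^-1) by inverse.
rewrite !crV_1 // !(@crV_swap E oo u (Some p)); try distinct.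
have -> : crV oo (Some c3) (Some p) u = Lin t3 t4 by direct.
have -> : crV oo (Some c4) (Some p) u = Lin t4 t3 by direct.
have -> : crV oo z (Some p) u = T (t1 * t2) by inverse.
rewrite !(add0r, addr0) [Y in - Y - _](AC (2*2) ((1*4)*(3*2))) /=.
rewrite !T_onem_sum // -mulr2n !add_onem !opprB.
rewrite [LHS](AC (2*1*2*1*2) (1*4*8*(2*(3*7))*(5*6))) /= addNr addr0.
congr (_ + _); rewrite !mulrS mulr0n addr0 !opprD.
by rewrite addrNK addrAC addrA.
Qed.

Lemma W_defined_t1 : W_defined phi A B C x.
Proof.
rewrite /W_defined; split.
  by rewrite eval_invol // cr_symb_definedE orbT.
split=> y1 y2 y3; rewrite !((perm_mem fA), (perm_mem fB), (perm_mem fC)) !inE;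
  move=> _ _ /orP[]/eqP->; rewrite cr_symb_definedE;
  by rewrite (_ : x != _) ?orbT //; distinct.
Qed.

Lemma W_defined_infty : W_defined phi A B C oo.
Proof.
rewrite /W_defined; split.
  by rewrite eval_invol_infty cr_symb_definedE orbT.
split=> y1 y2 y3; rewrite !((perm_mem fA), (perm_mem fB), (perm_mem fC)) !inE;
  move=> /orP[]/eqP-> /orP[]/eqP-> /orP[]/eqP->; rewrite cr_symb_definedE;
  by rewrite ?orbT.
Qed.

(* Indexing by [nat] lets the sums over indices and permutations be expanded
   without computing with ordinals. *)
Let t (i : nat) := nth 0 [:: t1; t2; t3; t4] i.

Let sum_single :
  Vclass (\sum_(i < 4) symb_fin (t i)) = T t1 + T t2 + (T t3 + T t4).
Proof. by rewrite raddf_sum !big_ord_recl big_ord0 addr0 addrA. Qed.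

Let sum_Lin :
  Vclass (\sum_(i < 4) \sum_(j < 4 | i != j)
    symb_fin ((1 - t i) / (1 - (t j)^-1)))
  = Lin t1 t2 + Lin t2 t1 + (Lin t3 t4 + Lin t4 t3)
     + (Lin t1 t3 + Lin t3 t1 + (Lin t2 t4 + Lin t4 t2)
        + (Lin t1 t4 + Lin t4 t1 + (Lin t2 t3 + Lin t3 t2))).
Proof.
rewrite raddf_sum; under eq_bigr do rewrite raddf_sum.
exact: (sum_pair4 (fun i j => Lin (t i) (t j))).
Qed.

(* [t_i t_j] and [t_k t_l] are inverse to each other, so each splitting
   [ij|kl] is counted four times. *)
Let sum_prod :
  Vclass (\sum_(i < 4) \sum_(j < 4 | i != j) symb_fin (t i * t j))
  = (T (t1 * t2) + (T (t1 * t3) + T (t1 * t4))) *+ 4.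
Proof.
rewrite raddf_sum; under eq_bigr do rewrite raddf_sum.
rewrite [LHS](sum_pair4 (fun i j => T (t i * t j))) /t /=.
have quad (a b a' b' : E) : a * b * (a' * b') = 1 ->
    T (a * b) + T (b * a) + (T (a' * b') + T (b' * a')) = T (a * b) *+ 4.
  move=> /mulr1_eq ab1.
  by rewrite (mulrC b) (mulrC b') -ab1 T_inv -!mulr2n -mulrnA.
by rewrite !quad -?mulrnDl // -?mulrA; rewrite -[RHS]prod_t; ring.
Qed.

Let sum_Quad :
  Vclass (\sum_(s : 'S_4) symb_fin
    ((1 - t (s (inord 0))) * (1 - t (s (inord 1)))
      / ((1 - (t (s (inord 2)))^-1) * (1 - (t (s (inord 3)))^-1))))
  = (Quad t1 t2 t3 t4 + (Quad t2 t3 t1 t4 + Quad t2 t4 t1 t3)) *+ 8.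
Proof.
have p1423 : t1 * t4 * t2 * t3 = 1 by rewrite -[RHS]prod_t; ring.
have p1324 : t1 * t3 * t2 * t4 = 1 by rewrite -[RHS]prod_t; ring.
rewrite raddf_sum.
rewrite [LHS](sum_perm4_splitting
  (F := fun i j k l => Quad (t i) (t j) (t k) (t l))) /t /=.
- rewrite -(@T_quad_swap _ t1 t4 t2 t3) // -(@T_quad_swap _ t1 t3 t2 t4) //.
  by rewrite -addrA [Y in _ + Y]addrC.
- by move=> i j k l; rewrite [(1 - nth _ _ j) * _]mulrC.
- by move=> i j k l; rewrite [(1 - (nth _ _ l)^-1) * _]mulrC.
- by apply: T_quad_swap.
- by apply: T_quad_swap.
- by apply: T_quad_swap.
Qed.

Lemma Vclass_R22 : Vclass (R22 t1 t2 t3) =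
  T t1 + T t2 + (T t3 + T t4)
  + (Lin t1 t2 + Lin t2 t1 + (Lin t3 t4 + Lin t4 t3)
     + (Lin t1 t3 + Lin t3 t1 + (Lin t2 t4 + Lin t4 t2)
        + (Lin t1 t4 + Lin t4 t1 + (Lin t2 t3 + Lin t3 t2))))
  - (T (t1 * t2) + (T (t1 * t3) + T (t1 * t4)))
  - (Quad t1 t2 t3 t4 + (Quad t2 t3 t1 t4 + Quad t2 t4 t1 t3))
  - T 1 *+ 3.
Proof.
have divK (m : nat) (v : V E) : (m.+1%:R^-1 : rat) *: (v *+ m.+1) = v.
  by rewrite -scaler_nat scalerA mulVf ?scale1r // Num.Theory.pnatr_eq0.
rewrite /R22.
have -> : tnth [tuple t1; t2; t3; (t1 * t2 * t3)^-1] = (fun i => t i).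
  by apply/funext => i; rewrite (tnth_nth 0).
rewrite !VclassB VclassD !VclassZ sum_single sum_Lin sum_prod sum_Quad.
by rewrite !divK scaler_nat.
Qed.

Lemma R22_is_W_difference : W_difference_class (Vclass (R22 t1 t2 t3)).
Proof.
exists phi, A, B, C, oo, x; split.
- by rewrite deg_invol.
- apply/and3P; split=> //; apply/eqP => -[C0].
  by have := C_neq0; rewrite -C0 eqxx.
- exact: W_defined_infty.
- exact: W_defined_t1.
have regroup (M : zmodType) (a b c d e f g h i k : M) :
    a + b + (c + d + e) - (f + g) - (h + i) - k
    = (b + d - f - k) - (h - e + g + i - a - c).
  by rewrite !opprD !opprK !addrA [LHS](ACl (2*4*6*10*8*5*7*9*1*3)).
rewrite Vclass_R22 VclassB W_at_t1 W_at_infty.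
exact: regroup.
Qed.

End Configuration.

(** * Independent variables *)

(** Distinct values at a rational point separate polynomials, and fractions
    and field embeddings do not identify distinct polynomials. *)
Lemma neq_by_specialization (L : fieldType) (iota : {rmorphism Qt -> L})
    (v : 'I_3 -> rat) (f g : {mpoly rat[3]}) :
  f.@[v] != g.@[v] -> iota (tofrac f) != iota (tofrac g).
Proof.
rewrite (inj_eq (fmorph_inj iota)) tofrac_eq.
by apply: contra => /eqP->.
Qed.

(* [L], with the embedding [iota], is an algebraic closure of Q(t_1,t_2,t_3). *)
Theorem proposition3p7 (L : closedFieldType) (iota : {rmorphism Qt -> L})
    (L_algebraic : forall z : L, algebraicOver iota z) :
  in_span (@W_difference_class L)
    (Vclass (R22 (iota (tgen (inord 0))) (iota (tgen (inord 1)))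
                 (iota (tgen (inord 2))))).
Proof.
have e0 : 0 = iota (tofrac 0) by rewrite !rmorph0.
have e1 : 1 = iota (tofrac 1) by rewrite !rmorph1.
apply/mem_in_span/R22_is_W_difference; rewrite ?e0 ?e1 /tgen -?rmorphM;
  apply: (@neq_by_specialization L iota (fun=> 2%:R));
  by rewrite ?mevalM !mevalXU ?meval0 ?meval1 -?natrM ?Num.Theory.pnatr_eq0
     ?Num.Theory.pnatr_eq1.
Qed.
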